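(* Let $0<\lambda<1$ and $t\in[0,T]$. Then, almost surely, $$0\le V_t-V^\lambda_t\le N(t)\Big(1-\ln(1-e^{-1})+\mathbb E\big[\ln(\overline V_{t,T}\vee 1)\,\big|\,\mathcal F_t\big]\Big)\,\big[\lambda-\lambda\ln(\lambda)\big],$$ where $N(t)=(N+1)-\max\{i:\ t_i<t\}$ and $\overline V_{t,T}=\max_{t_i\in S\cap[t,T)}V_{t_i}$.
   Context: Setting. $(\Omega,\mathcal F,\mathbb P,\mathbb F)$ is a filtered probability space whose filtration $\mathbb F=(\mathcal F_t)_{t\ge0}$ satisfies the usual conditions; martingales are càdlàg. $T>0$, $S=\{t_0,t_1,\dots,t_N\}$ with $0=t_0<t_1<\dots<t_N<T$, and $t_{N+1}:=T$. $P$ is a non-negative $\mathbb F$-adapted process with $\max_{u\in S\cup\{T\}}\mathbb E[P_u]<\infty$. $\mathcal T_{t,T}(S)$ is the set of $\mathbb F$-stopping times with values in $(S\cup\{T\})\cap[t,T]$. $X_{t+}$ denotes the right limit of a process $X$ at $t$; $x^+=\max(x,0)$, $x\vee y=\max(x,y)$. Value process. $V_t=\operatorname{ess\,sup}_{\tau\in\mathcal T_{t,T}(S)}\mathbb E[P_\tau|\mathcal F_t]$ for $t\in[0,T]$. It has left and right limits and satisfies $V_t=P_T-(M_T-M_t)+\sum_{t\le t_i<T}(P_{t_i}-V_{t_i+})^+$ with $M$ a uniformly integrable martingale. Entropy-regularised value. For $x\ne0$, $\Psi(x)=\frac1x\ln\big(\frac{e^x-1}{x}\big)$, $\Psi(0)=\frac12$,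 and $\Phi(x)=x\Psi(x)$ (so $\Phi(0)=0$). For $\lambda>0$, $(V^\lambda,M^\lambda)$ is the unique pair ($V^\lambda$ of class (D), $M^\lambda$ a uniformly integrable martingale with $M^\lambda_0=0$) solving $$V^\lambda_t=P_T-(M^\lambda_T-M^\lambda_t)+\sum_{t\le t_i<T}\lambda\,\Phi\Big(\frac{P_{t_i}-V^\lambda_{t_i+}}{\lambda}\Big),\qquad t\in[0,T].$$ Equivalently: $V^\lambda_T=P_T$, $V^\lambda_t=\mathbb E[V^\lambda_{t_{j+1}}|\mathcal F_t]$ for $t\in(t_j,t_{j+1}]$, $V^\lambda_{t_j+}=\mathbb E[V^\lambda_{t_{j+1}}|\mathcal F_{t_j}]$ and $V^\lambda_{t_j}=V^\lambda_{t_j+}+\lambda\Phi(\lambda^{-1}(P_{t_j}-V^\lambda_{t_j+}))$. Conventions: $\max\emptyset:=0$, both in $N(t)$ (so $N(0)=N+1$) and in $\overline V_{t,T}$. *)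

(* Defs.v *)
From HB Require Import structures.
From mathcomp Require Import all_boot all_order all_algebra.
From mathcomp Require Import all_classical all_reals all_analysis.

Set Implicit Arguments.
Unset Strict Implicit.
Unset Printing Implicit Defensive.

Import Order.TTheory GRing.Theory Num.Def Num.Theory.
Import numFieldNormedType.Exports.

Local Open Scope classical_set_scope.
Local Open Scope ring_scope.

Section Regularisation.
Context {R : realType}.

Definition Psi (x : R) : R :=
  if x == 0 then 2^-1 else x^-1 * ln ((expR x - 1) / x).

Definition Phi (x : R) : R := x * Psi x.

End Regularisation.

Section Conditioning.
Context {d : measure_display} {Omega : measurableType d} {R : realType}.
Variable Pr : probability Omega R.

Definition measurable_wrt (G : set (set Omega)) (X : Omega -> R) : Prop :=
  measurable_fun [set: g_sigma_algebraType G]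
    (X : g_sigma_algebraType G -> R).

(* [Y] is a version of the conditional expectation of the integrable random
   variable [X] given the sub-sigma-algebra [G]. *)
Definition is_condexp (G : set (set Omega)) (X Y : Omega -> R) : Prop :=
  [/\ Pr.-integrable setT (EFin \o X),
      measurable_wrt G Y,
      Pr.-integrable setT (EFin \o Y) &
      forall A, G A ->
        (\int[Pr]_(w in A) (Y w)%:E = \int[Pr]_(w in A) (X w)%:E)%E].

(* Some version of E[X | G]; it is only determined up to almost sure equality.
   The default value is used only when there is no version, i.e. when [X] is
   not integrable. *)
Definition condexp (G : set (set Omega)) (X : Omega -> R) : Omega -> R :=
  xget (cst 0) [set Y | is_condexp G X Y].

(* [Z] is a version of the essential supremum of a family of random variables,
   i.e. a least almost sure upper bound ([ess_sup] of the library is the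
   essential supremum of a single function, a number). *)
Definition is_family_ess_sup (A : set (Omega -> R)) (Z : Omega -> R) : Prop :=
  [/\ measurable_fun setT Z,
      forall Y, A Y -> {ae Pr, forall w, Y w <= Z w} &
      forall Z', measurable_fun setT Z' ->
        (forall Y, A Y -> {ae Pr, forall w, Y w <= Z' w}) ->
        {ae Pr, forall w, Z w <= Z' w}].

Definition uniformly_integrable (A : set (Omega -> R)) : Prop :=
  (forall X, A X -> measurable_fun setT X) /\
  forall e : R, 0 < e -> exists K : R, forall X, A X ->
    (\int[Pr]_(w in [set w | (K < `|X w|)%R]) `|X w|%:E <= e%:E)%E.

End Conditioning.

Section Processes.
Context {d : measure_display} {Omega : measurableType d} {R : realType}.
Variable Pr : probability Omega R.
Implicit Types (F : R -> set (set Omega)) (X M : R -> Omega -> R).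

(* The index set of filtrations is [0, +oo[; [F t] is unconstrained for
   negative [t]. *)
Definition filtration F : Prop :=
  [/\ forall t, 0 <= t -> sigma_algebra setT (F t),
      forall t, 0 <= t -> F t `<=` measurable &
      forall s t, 0 <= s -> s <= t -> F s `<=` F t].

Definition usual_conditions F : Prop :=
  (forall t, 0 <= t -> \bigcap_(u in `]t, +oo[) F u `<=` F t) /\
  (forall A, Pr.-negligible A -> F 0 A).

(* All stopping times used below are bounded, hence real-valued. *)
Definition stopping_time F (tau : Omega -> R) : Prop :=
  (forall w, 0 <= tau w) /\
  (forall t, 0 <= t -> F t [set w | tau w <= t]).

Definition stopped X (tau : Omega -> R) : Omega -> R := fun w => X (tau w) w.

Definition right_limit X (t : R) : Omega -> R :=
  fun w => lim (X s w @[s --> t^'+]).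

(* Processes are considered on the time interval [0, T]. *)
Variable T : R.

Definition adapted F X : Prop :=
  forall t, 0 <= t <= T -> measurable_wrt (F t) (X t).

Definition cadlag X : Prop :=
  forall w,
    (forall t, 0 <= t < T -> X s w @[s --> t^'+] --> X t w) /\
    (forall t, 0 < t <= T -> cvg (X s w @[s --> t^'-])).

Definition martingale F M : Prop :=
  [/\ adapted F M, cadlag M,
      forall t, 0 <= t <= T -> Pr.-integrable setT (EFin \o M t) &
      forall s t, 0 <= s -> s <= t -> t <= T ->
        is_condexp Pr (F s) (M t) (M s)].

Definition ui_martingale F M : Prop :=
  martingale F M /\ uniformly_integrable Pr [set M t | t in `[0, T]].

Definition classD F X : Prop :=
  adapted F X /\
  uniformly_integrable Pr
    [set stopped X tau | tau in
      [set tau | stopping_time F tau /\ forall w, tau w <= T]].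

Definition stopping_times F (S : set R) (t : R) : set (Omega -> R) :=
  [set tau | stopping_time F tau /\
    forall w, (S `|` [set T]) (tau w) /\ t <= tau w <= T].

(* For each [t], the value [V t] is an arbitrary version of the essential
   supremum, so this covers in particular the version with left and right
   limits. *)
Definition value_process F (S : set R) (P V : R -> Omega -> R) : Prop :=
  forall t, 0 <= t <= T ->
    is_family_ess_sup Pr
      [set condexp Pr (F t) (stopped P tau) | tau in stopping_times F S t]
      (V t).

Definition exercise_dates (N : nat) (s : 'I_N.+1 -> R) : Prop :=
  [/\ s ord0 = 0, forall i j : 'I_N.+1, (i < j)%N -> s i < s j &
      s ord_max < T].

Definition regularised_value F (N : nat) (s : 'I_N.+1 -> R) (P : R -> Omega -> R)
    (lambda : R) (Vl Ml : R -> Omega -> R) : Prop :=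
  [/\ classD F Vl, ui_martingale F Ml, {ae Pr, forall w, Ml 0 w = 0} &
      {ae Pr, forall w, forall t, 0 <= t <= T ->
        Vl t w = P T w - (Ml T w - Ml t w)
          + \sum_(i < N.+1 | t <= s i < T)
              lambda * Phi ((P (s i) w - right_limit Vl (s i) w) / lambda)}].

Definition remaining_dates (N : nat) (s : 'I_N.+1 -> R) (t : R) : nat :=
  (N.+1 - \max_(i < N.+1 | (s i < t)%R) i)%N.

(* As [V] is non-negative almost surely, starting the maximum at 0 only
   implements the convention that the maximum over the empty set is 0. *)
Definition running_max (N : nat) (s : 'I_N.+1 -> R) (V : R -> Omega -> R)
    (t : R) : Omega -> R :=
  fun w => \big[Num.max/0]_(i < N.+1 | t <= s i < T) V (s i) w.

End Processes.

(* Main.v *)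
Require Import Defs.
From HB Require Import structures.
From mathcomp Require Import all_boot all_order all_algebra.
From mathcomp Require Import all_classical all_reals all_analysis.
From mathcomp Require Import measurable_realfun.
From mathcomp Require Import ring lra.

Set Implicit Arguments.
Unset Strict Implicit.
Unset Printing Implicit Defensive.

Import Order.TTheory GRing.Theory Num.Def Num.Theory.
Import numFieldNormedType.Exports.

Local Open Scope classical_set_scope.
Local Open Scope ring_scope.

(** The theorem compares an optimal stopping problem with its entropic
    regularisation, in which the maximum of payoff and continuation value at an
    exercise date is replaced by a soft maximum.

    Along a trajectory, let p_k be the payoff at the k-th date, c_k the right
    limit of Vl there (the continuation value) and M the martingale.  The
    equation of Vl says that Vl - M only moves at exercise dates, by
    lambda * Phi ((p_k - c_k) / lambda), and that Vl equals at the date the soft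
    maximum of p_k and c_k.  The soft maximum lies between the minimum and the
    maximum of the two values ([regularised_max_between]), and misses the maximum
    by at most lambda * (- ln (1 - e^-1) - ln lambda + ln (max (|p_k - c_k|, 1)))
    ([regularised_max_gap]).

    Lower bound.  Let tau be the first remaining date with p_k >= c_k.  Before tau
    the increments of Vl - M are non-positive and at tau the soft maximum is at
    most the payoff, so that Vl_t <= P_tau - (M_tau - M_t).  Taking conditional
    expectations, optional stopping gives Vl_t <= E[P_tau | F_t] <= V_t
    ([compensated_le_value]).  The same argument started just after a date gives
    c_k <= V at that date, and stopping at the first date with p_k <= c_k gives
    c_k >= 0 ([compensated_ge0]).  Hence |p_k - c_k| is at most V at the k-th
    date, and so at most the running maximum.

    Upper bound.  For every admissible tau, the payoff P_tau is at most
    Vl_t + (M_tau - M_t) plus the sum of the gaps over the remaining dates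
    ([stopped_le_compensated_gap]).  Each gap is bounded by the scalar estimate
    applied to the running maximum, and there are at most N(t) of them.  The
    conditional expectation of this bound does not involve tau, hence dominates
    the essential supremum V_t.

    Conditional expectations exist by the Radon-Nikodym theorem
    ([is_condexp_ex]), and optional stopping is elementary because stopping
    times take finitely many values ([optional_stopping]). *)

(** * The entropic soft maximum *)

Section PhiTheory.
Context {R : realType}.
Implicit Types x p c lambda : R.

Lemma PhiE x : x != 0 -> Phi x = ln ((expR x - 1) / x).
Proof. by move=> x0; rewrite /Phi /Psi (negbTE x0) mulrA divff // mul1r. Qed.

Lemma expRB1_div_gt0 x : x != 0 -> 0 < (expR x - 1) / x.
Proof.
rewrite neq_lt => /orP[x0|x0].
  by rewrite nmulr_lgt0 ?invr_lt0 // subr_lt0 expR_lt1.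
by rewrite divr_gt0 // subr_gt0 expR_gt1.
Qed.

(** The substitution x -> -x multiplies (e^x - 1) / x by e^-x; it reduces every
    estimate on [Phi] to the half-line x >= 0. *)
Lemma PhiN x : Phi (- x) = Phi x - x.
Proof.
have [->|x0] := eqVneq x 0; first by rewrite oppr0 addr0.
rewrite !PhiE ?oppr_eq0 // -[x in RHS](expRK x) -ln_div ?posrE ?expR_gt0 //;
  last first.
  by rewrite expRK; exact: expRB1_div_gt0.
rewrite expRK expRN; congr ln.
have := expR_gt0 x; move: (expR x) => e e0.
by field; rewrite x0 gt_eqF.
Qed.

Lemma Phi_ge0 x : 0 <= x -> 0 <= Phi x.
Proof.
rewrite le_eqVlt => /predU1P[<-|x0]; first by rewrite /Phi mul0r.
rewrite PhiE ?gt_eqF // ln_ge0 // ler_pdivlMr // mul1r lerBrDl.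
exact: expR_ge1Dx.
Qed.

Lemma Phi_le_id x : 0 <= x -> Phi x <= x.
Proof.
rewrite le_eqVlt => /predU1P[<-|x0]; first by rewrite /Phi mul0r.
rewrite -subr_le0 -PhiN PhiE ?oppr_eq0 ?gt_eqF // ln_le0 //.
rewrite invrN mulrN -mulNr opprB ler_pdivrMr // mul1r lerBlDl -lerBlDr.
exact: expR_ge1Dx.
Qed.

(** Convexity: on [0, 1] the graph of e^-x lies below its chord. *)
Lemma expRN_chord x : 0 <= x <= 1 -> expR (- x) <= 1 - x * (1 - expR (- 1)).
Proof.
move=> /andP[x0 x1].
have := convex_expR (Itv01 x0 x1) (- 1) 0.
rewrite !convRE /= mulr0 addr0 mulrN1 expR0 mulr1 => /le_trans; apply.
by rewrite /unstable.onem; lra.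
Qed.

(** The gap x - Phi x is ln (x / (1 - e^-x)).  For x >= 1 the denominator is at
    least 1 - e^-1; for x <= 1 the chord bound gives x / (1 - e^-x) <=
    1 / (1 - e^-1), so that the constant of the theorem is the value at x = 1. *)
Lemma Phi_gap x : 0 <= x ->
  x - Phi x <= - ln (1 - expR (- 1)) + ln (Num.max x 1).
Proof.
have e1 : 0 < 1 - expR (- 1) :> R by rewrite subr_gt0 expR_lt1 oppr_lt0.
rewrite le_eqVlt => /predU1P[<-|x0].
  rewrite /Phi mul0r subr0 max_r // ln1 addr0 oppr_ge0 ln_le0 //.
have m0 : 0 < Num.max x 1 by rewrite lt_max ltr01 orbT.
have -> : x - Phi x = - Phi (- x) by rewrite PhiN opprB.
have xe0 : 0 < (expR (- x) - 1) / - x.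
  by apply: expRB1_div_gt0; rewrite oppr_eq0 gt_eqF.
rewrite PhiE ?oppr_eq0 ?gt_eqF // [leRHS]addrC -ln_div ?posrE // -lnV ?posrE //.
rewrite ler_ln ?posrE ?invr_gt0 //; last exact: divr_gt0.
rewrite invrN mulrN -mulNr opprB invf_div.
have ex : 0 < 1 - expR (- x) by rewrite subr_gt0 expR_lt1 oppr_lt0.
rewrite ler_pdivrMr // mulrAC ler_pdivlMr //.
have [x1|x1] := leP x 1.
  by rewrite mul1r; have := @expRN_chord x; rewrite (ltW x0) x1 => /(_ isT); lra.
rewrite ler_pM2l // lerD2l lerN2 ler_expR; lra.
Qed.

(** Since exp (Phi x) is the mean of e^(ux) over u in [0, 1], the quantity in the
    middle is lambda * ln of the mean of e^(v/lambda) for v between c and p: it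
    is a soft maximum, squeezed between the two values.  The proof only uses
    that Phi x lies between 0 and x. *)
Lemma regularised_max_between lambda p c : 0 < lambda ->
  Num.min p c <= c + lambda * Phi ((p - c) / lambda) <= Num.max p c.
Proof.
move=> l0; set x := (p - c) / lambda.
have xE : lambda * x = p - c by rewrite mulrC divfK // gt_eqF.
have [cp|pc] := leP c p.
  have x0 : 0 <= x by rewrite divr_ge0 ?subr_ge0 // ltW.
  apply/andP; split; first by rewrite lerDl mulr_ge0 ?Phi_ge0 // ltW.
  by rewrite -lerBrDl -xE ler_pM2l // Phi_le_id.
have x0 : 0 <= - x by rewrite oppr_ge0 ltW // pmulr_llt0 ?invr_gt0 // subr_lt0.
have -> : Phi x = Phi (- x) + x by rewrite PhiN subrK.
rewrite mulrDr xE; apply/andP; split.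
  have : 0 <= lambda * Phi (- x) by rewrite mulr_ge0 ?Phi_ge0 // ltW.
  lra.
have : lambda * Phi (- x) <= lambda * - x by rewrite ler_pM2l // Phi_le_id.
by rewrite mulrN xE; lra.
Qed.

(** Both signs of p - c give lambda * (|x| - Phi |x|) with x = (p - c) / lambda,
    by the reflection rule [PhiN]; dividing by lambda < 1 inside the logarithm
    costs the term - ln lambda. *)
Lemma regularised_max_gap lambda p c : 0 < lambda -> lambda < 1 ->
  Num.max p c - (c + lambda * Phi ((p - c) / lambda)) <=
  lambda * (- ln (1 - expR (- 1)) - ln lambda + ln (Num.max `|p - c| 1)).
Proof.
move=> l0 l1; set x := (p - c) / lambda.
have xE : lambda * x = p - c by rewrite mulrC divfK // gt_eqF.
have -> : Num.max p c - (c + lambda * Phi x) = lambda * (`|x| - Phi `|x|).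
  have [cp|pc] := leP c p.
    rewrite ger0_norm; last by rewrite divr_ge0 ?subr_ge0 // ltW.
    by rewrite mulrBr xE; lra.
  rewrite ler0_norm; last by rewrite ltW // pmulr_llt0 ?invr_gt0 // subr_lt0.
  by rewrite PhiN; lra.
rewrite ler_pM2l // (le_trans (Phi_gap (normr_ge0 x))) // -addrA lerD2l.
rewrite addrC -ln_div ?posrE ?lt_max ?ltr01 ?orbT // ler_ln ?posrE; last 2 first.
- by rewrite lt_max ltr01 orbT.
- by rewrite divr_gt0 // lt_max ltr01 orbT.
rewrite ler_pdivlMr // maxr_pMl ?(ltW l0) // mul1r ge_max.
have -> : `|x| * lambda = `|p - c|
  by rewrite -xE (normrM lambda x) (gtr0_norm l0) mulrC.
by rewrite !le_max lexx /= (ltW l1) orbT.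
Qed.
End PhiTheory.

(** * Integrable random variables *)

Section IntegrableVariables.
Context {d : measure_display} {Omega : measurableType d} {R : realType}.
Variable Pr : probability Omega R.
Implicit Types X Y W : Omega -> R.

Local Notation L1 X := (Pr.-integrable setT (EFin \o X)).

Lemma L1D X Y : L1 X -> L1 Y -> L1 (fun w => X w + Y w).
Proof. by move=> iX iY; exact: (integrableD _ iX iY). Qed.

Lemma L1Z a X : L1 X -> L1 (fun w => a * X w).
Proof. by move=> iX; exact: (integrableZl _ a iX). Qed.

Lemma L1B X Y : L1 X -> L1 Y -> L1 (fun w => X w - Y w).
Proof. by move=> iX iY; exact: (integrableB _ iX iY). Qed.

Lemma L1_cst a : L1 (cst a).
Proof. exact: finite_measure_integrable_cst. Qed.

Lemma L1_sum (I : Type) (r : seq I) (p : pred I) (X : I -> Omega -> R) :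
  (forall i, p i -> L1 (X i)) -> L1 (fun w => \sum_(i <- r | p i) X i w).
Proof.
move=> iX; have := integrable_sum measurableT r iX.
by apply: eq_integrable => // w _ /=; rewrite sumEFin.
Qed.

Lemma L1_restrict A X : measurable A -> L1 X -> L1 (X \_ A).
Proof.
move=> mA iX; rewrite -restrict_EFin; apply/(integrable_mkcond _ mA).
exact: integrableS iX.
Qed.

Lemma L1_ae_bound X W :
  measurable_fun setT X -> L1 W ->
  {ae Pr, forall w, `|X w| <= W w} -> L1 X.
Proof.
move=> mX /integrableP[mW Woo] XW; apply/integrableP; split.
  exact/measurable_EFinP.
apply: le_lt_trans Woo; apply: ae_ge0_le_integral => //.
- by apply: measurableT_comp => //; exact/measurable_EFinP.
- exact: measurableT_comp.
- by apply: filterS XW => w XW _; rewrite lee_fin (le_trans XW) ?ler_norm.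
Qed.

(** Off the set where [X] exceeds the truncation level it is bounded, and on that
    set its integral is at most 1. *)
Lemma uniformly_integrable_L1 (A : set (Omega -> R)) X :
  uniformly_integrable Pr A -> A X -> L1 X.
Proof.
move=> [Ameas AUI] AX; have mX := Ameas _ AX.
have [K /(_ _ AX) XK] := AUI 1 ltr01.
apply/integrableP; split; first exact/measurable_EFinP.
set B := [set w | K < `|X w|] in XK.
have mB : measurable B.
  rewrite -[B]setTI; apply: measurable_fun_ltr => //.
  exact: measurableT_comp mX.
have mabs D : measurable_fun D (fun w => `|(X w)%:E|%E).
  apply: measurable_funTS; apply: measurableT_comp => //.
  exact/measurable_EFinP.
rewrite -(setUv B) ge0_integral_setU //=; last 2 first.
- exact: measurableC.
- exact/disj_setPCl.
apply: (@le_lt_trans _ _ (1%:E + \int[Pr]_(w in ~` B) (cst `|K|%:E w))%E).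
  apply: leeD => //; apply: ge0_le_integral => //; first exact: measurableC.
  move=> w /= /negP; rewrite -leNgt lee_fin => /le_trans; apply.
  exact: ler_norm.
rewrite integral_cst; last exact: measurableC.
rewrite lte_add_pinfty ?ltry // lte_mul_pinfty ?lee_fin //.
by rewrite (le_lt_trans (probability_le1 _ _)) ?ltry //; exact: measurableC.
Qed.

End IntegrableVariables.

(** * Conditional expectation *)

Section CondExp.
Context {d : measure_display} {Omega : measurableType d} {R : realType}.
Variable Pr : probability Omega R.
Variable G : set (set Omega).
Hypotheses (sigmaG : sigma_algebra setT G) (G_meas : G `<=` measurable).
Implicit Types X Y Z : Omega -> R.

Local Notation L1 X := (Pr.-integrable setT (EFin \o X)).

Lemma measurable_gE (A : set Omega) :
  measurable (A : set (g_sigma_algebraType G)) <-> G A.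
Proof. by rewrite measurable_g_measurableTypeE. Qed.

Lemma measurable_wrtP X :
  measurable_wrt G X <-> forall B, measurable B -> G (X @^-1` B).
Proof.
split=> [mX B mB|GX].
  apply/measurable_gE; rewrite -[X in measurable X]setTI; exact: mX.
by move=> _ B mB; rewrite setTI; apply/measurable_gE; exact: GX.
Qed.

Lemma measurable_wrt_measurable X :
  measurable_wrt G X -> measurable_fun setT X.
Proof.
move=> /measurable_wrtP GX _ B mB; rewrite setTI; exact: G_meas (GX B mB).
Qed.

Lemma measurable_id_sub :
  measurable_fun setT (id : Omega -> g_sigma_algebraType G).
Proof.
move=> _ A /measurable_gE GA; rewrite setTI; exact: G_meas.
Qed.

(* Radon-Nikodym is applied on the measurable space generated by [G], to the
   traces on [G] of [Pr] and of the charge with density [X]; both are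
   push-forwards along the identity map. *)
Let toG : Omega -> g_sigma_algebraType G := id.

Let trace_measure : set (g_sigma_algebraType G) -> \bar R := pushforward Pr toG.

Let trace_measure0 : trace_measure set0 = 0%E.
Proof. by rewrite /trace_measure /pushforward preimage_set0 measure0. Qed.

Let trace_measure_ge0 A : (0 <= trace_measure A)%E.
Proof. by rewrite /trace_measure /pushforward; exact: measure_ge0. Qed.

Let trace_measure_sigma_additive : semi_sigma_additive trace_measure.
Proof.
move=> F mF tF mUF; apply: (@measure_semi_sigma_additive _ _ _ Pr) => //.
- by move=> n; apply: G_meas; apply/measurable_gE; exact: mF.
- by apply: G_meas; apply/measurable_gE.
Qed.

HB.instance Definition _ := isMeasure.Build _ _ _ trace_measure
  trace_measure0 trace_measure_ge0 trace_measure_sigma_additive.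

Let trace_measure_finite : fin_num_fun trace_measure.
Proof.
move=> A /measurable_gE/G_meas mA; exact: fin_num_measure.
Qed.

HB.instance Definition _ := Measure_isFinite.Build _ _ _ trace_measure
  trace_measure_finite.

Let trace_charge X (iX : Pr.-integrable setT (EFin \o X)) :
  set (g_sigma_algebraType G) -> \bar R := pushforward (induced_charge iX) toG.

Section trace_charge.
Variables (X : Omega -> R) (iX : Pr.-integrable setT (EFin \o X)).

Let trace_charge0 : trace_charge iX set0 = 0%E.
Proof. by rewrite /trace_charge /pushforward preimage_set0 charge0. Qed.

Let trace_charge_finite A : measurable A -> trace_charge iX A \is a fin_num.
Proof.
move=> /measurable_gE/G_meas mA.
exact: (fin_num_measure (induced_charge iX)).
Qed.

Let trace_charge_sigma_additive : semi_sigma_additive (trace_charge iX).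
Proof.
move=> F mF tF mUF;
apply: (@charge_semi_sigma_additive _ _ _ (induced_charge iX)) => //.
- by move=> n; apply: G_meas; apply/measurable_gE; exact: mF.
- by apply: G_meas; apply/measurable_gE.
Qed.

HB.instance Definition _ := isCharge.Build _ _ _ (trace_charge iX)
  trace_charge0 trace_charge_finite trace_charge_sigma_additive.
End trace_charge.

Lemma is_condexp_ex X : Pr.-integrable setT (EFin \o X) ->
  exists Y, is_condexp Pr G X Y.
Proof.
move=> iX.
have numu : trace_charge iX `<< trace_measure.
  apply/null_content_dominatesP => A /measurable_gE/G_meas mA PrA.
  rewrite /trace_charge /pushforward /induced_charge /=.
  rewrite (ae_eq_integral (cst 0%E)) ?integral0 //.
    by apply: measurable_funTS; exact: measurable_int iX.
  by exists A; split => // w /= /not_implyP[].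
have [f [ffin fi fE]] : exists f : g_sigma_algebraType G -> \bar R,
    [/\ forall w, f w \is a fin_num,
        trace_measure.-integrable setT f &
        forall A, measurable A ->
          trace_charge iX A = (\int[trace_measure]_(w in A) f w)%E].
  exists (Radon_Nikodym (trace_charge iX) trace_measure); split.
  - by move=> w; exact: Radon_Nikodym_fin_num.
  - exact: Radon_Nikodym_integrable.
  - by move=> A mA; exact: Radon_Nikodym_integral.
have mf : measurable_fun setT f by exact: measurable_int fi.
have mid := measurable_id_sub.
have fineE : EFin \o (fine \o f) = f :> (Omega -> \bar R).
  by apply/funext => w /=; rewrite fineK.
have fi' : Pr.-integrable setT (f : Omega -> \bar R).
  apply/integrableP; split; first exact: measurableT_comp mid.
  have /integrableP[_] := fi; apply: le_lt_trans.
  rewrite ge0_integral_pushforward //.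
  exact: measurableT_comp.
exists (fine \o f); split => //.
- rewrite /measurable_wrt; apply: measurableT_comp => //.
- by rewrite fineE.
- move=> A GA; have mA : measurable (A : set (g_sigma_algebraType G)).
    exact/measurable_gE.
  transitivity (\int[trace_measure]_(w in A) f w)%E; last by rewrite -fE.
  rewrite integral_pushforward //.
    by apply: eq_integral => w _ /=; rewrite fineK.
  by apply: integrableS fi' => //; exact: G_meas.
Qed.

(** Existence of a version is what makes the chosen [condexp] meaningful. *)
Lemma condexpP X : L1 X -> is_condexp Pr G X (condexp Pr G X).
Proof. by move=> /is_condexp_ex; exact: xgetPex. Qed.

Lemma is_condexp_id X : L1 X -> measurable_wrt G X -> is_condexp Pr G X X.
Proof. by move=> iX mX; split. Qed.

Lemma is_condexpD X1 Y1 X2 Y2 : is_condexp Pr G X1 Y1 -> is_condexp Pr G X2 Y2 ->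
  is_condexp Pr G (fun w => X1 w + X2 w) (fun w => Y1 w + Y2 w).
Proof.
move=> [iX1 mY1 iY1 E1] [iX2 mY2 iY2 E2]; split.
- exact: L1D.
- exact: measurable_funD.
- exact: L1D.
- move=> A GA; have mA := G_meas GA.
  have iA Z : L1 Z -> Pr.-integrable A (EFin \o Z) by exact: integrableS.
  by rewrite (integralD_EFin mA (iA _ iY1) (iA _ iY2))
             (integralD_EFin mA (iA _ iX1) (iA _ iX2)) E1 // E2.
Qed.

Lemma is_condexpZ a X Y : is_condexp Pr G X Y ->
  is_condexp Pr G (fun w => a * X w) (fun w => a * Y w).
Proof.
move=> [iX mY iY E]; split.
- exact: L1Z.
- exact: measurable_funM.
- exact: L1Z.
- move=> A GA; have mA := G_meas GA.
  have iA Z : L1 Z -> Pr.-integrable A (EFin \o Z) by exact: integrableS.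
  by rewrite (integralZl mA (iA _ iY)) (integralZl mA (iA _ iX)) E.
Qed.

Lemma is_condexpB X1 Y1 X2 Y2 : is_condexp Pr G X1 Y1 -> is_condexp Pr G X2 Y2 ->
  is_condexp Pr G (fun w => X1 w - X2 w) (fun w => Y1 w - Y2 w).
Proof.
move=> E1 /(is_condexpZ (-1)) /(is_condexpD E1).
by under eq_fun do rewrite mulN1r; under [X in _ _ _ _ X]eq_fun do rewrite mulN1r.
Qed.

(** The event {Y < 0} belongs to [G], so that the integral of [Y] over it equals
    that of [X] and is non-negative; hence the event is null.  Monotonicity,
    and uniqueness up to null sets, follow by linearity. *)
Lemma is_condexp_ge0 X Y : is_condexp Pr G X Y ->
  {ae Pr, forall w, 0 <= X w} -> {ae Pr, forall w, 0 <= Y w}.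
Proof.
move=> [iX mY iY E] X0.
pose A := [set w | Y w < 0].
have GA : G A by move/measurable_wrtP : mY => /(_ `]-oo, 0[%classic); apply.
have mA := G_meas GA.
have iA Z : L1 Z -> Pr.-integrable A (EFin \o Z) by exact: integrableS.
have mEA Z : L1 Z -> measurable_fun A (EFin \o Z).
  by move=> /iA; exact: measurable_int.
have YX : (0 <= \int[Pr]_(w in A) (Y w)%:E)%E.
  rewrite E // (ae_eq_integral (fun w => (Num.max (X w) 0)%:E)) //.
  - by apply: integral_ge0 => w _; rewrite lee_fin le_max lexx orbT.
  - exact: mEA.
  - apply/measurable_EFinP; apply: measurable_maxr => //.
    by apply/measurable_EFinP; exact: mEA.
  - by apply: filterS X0 => w X0 _; rewrite max_l.
have : (\int[Pr]_(w in A) `|(Y w)%:E| = 0)%E.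
  apply/eqP; rewrite eq_le integral_ge0 // andbT.
  rewrite (eq_integral (fun w => (- (Y w)%:E)%E)); last first.
    by move=> w; rewrite inE => Aw; rewrite lee0_abs // lee_fin ltW.
  rewrite integralN ?oppe_le0 //.
  exact: integrable_add_def (iA _ iY).
move=> /(ae_eq_integral_abs _ mA (mEA _ iY)); apply: filterS => w Yw.
by rewrite leNgt; apply/negP => /[dup] Yw0 /Yw /= [Y0]; rewrite Y0 ltxx in Yw0.
Qed.

Lemma is_condexp_le X1 Y1 X2 Y2 :
  is_condexp Pr G X1 Y1 -> is_condexp Pr G X2 Y2 ->
  {ae Pr, forall w, X1 w <= X2 w} -> {ae Pr, forall w, Y1 w <= Y2 w}.
Proof.
move=> E1 E2 X12.
have : {ae Pr, forall w, 0 <= Y2 w - Y1 w}.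
  apply: is_condexp_ge0 (is_condexpB E2 E1) _.
  by apply: filterS X12 => w; rewrite subr_ge0.
by apply: filterS => w; rewrite subr_ge0.
Qed.

End CondExp.

(** * Stopping times with values in the exercise dates *)

Section Stopping.
Context {d : measure_display} {Omega : measurableType d} {R : realType}.
Variables (Pr : probability Omega R) (F : R -> set (set Omega)).
Variables (T : R) (N : nat) (s : 'I_N.+1 -> R).
Hypotheses (F_filtration : filtration F) (s_dates : exercise_dates T s).
Implicit Types (X : R -> Omega -> R) (tau : Omega -> R).

Local Notation L1 X := (Pr.-integrable setT (EFin \o X)).
Local Notation ST := (stopping_times T F (range s)).

Let Fsig (t : R) : 0 <= t -> sigma_algebra setT (F t).
Proof. by case: F_filtration => + _ _; exact. Qed.

Let Fmeas (t : R) : 0 <= t -> F t `<=` measurable.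
Proof. by case: F_filtration => _ + _; exact. Qed.

Let Fsub (u v : R) : 0 <= u -> u <= v -> F u `<=` F v.
Proof. by case: F_filtration => _ _; exact. Qed.

Lemma date_lt i j : (s i < s j) = (i < j)%N.
Proof.
case: (s_dates) => _ s_mono _; case: (ltngtP i j) => [/s_mono//|/s_mono ji|].
  by apply/negbTE; rewrite -leNgt ltW.
by move=> /val_inj ->; rewrite ltxx.
Qed.

Lemma date_le i j : (s i <= s j) = (i <= j)%N.
Proof. by rewrite leNgt date_lt -leqNgt. Qed.

Lemma date_ge0 i : 0 <= s i.
Proof. by case: (s_dates) => <- _ _; rewrite date_le. Qed.

Lemma date_ltT i : s i < T.
Proof.
case: (s_dates) => _ _; apply: le_lt_trans; rewrite date_le.
by rewrite -ltnS ltn_ord.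
Qed.

(** The exercise dates together with the maturity, which is the date [None]. *)
Definition date : option 'I_N.+1 -> R := oapp s T.

Lemma date_inj : injective date.
Proof.
move=> [i|] [j|] //= e; last 2 first.
- by have := date_ltT i; rewrite e ltxx.
- by have := date_ltT j; rewrite -e ltxx.
congr Some; apply/val_inj/eqP; rewrite eqn_leq -!date_le.
by rewrite e lexx.
Qed.

Lemma date_range o : 0 <= date o <= T.
Proof.
case: o => [i|] /=; first by rewrite date_ge0 ltW ?date_ltT.
by rewrite lexx (le_trans (date_ge0 ord0)) // ltW ?date_ltT.
Qed.

Lemma dateP v : (range s `|` [set T]) v <-> exists o, v = date o.
Proof.
split=> [[[i _ <-]|->]|[[i|] ->]]; first by exists (Some i).
- by exists None.
- by left; exists i.
- by right.
Qed.

Section StoppingTime.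
Variables (t : R) (tau : Omega -> R).
Hypotheses (t_range : 0 <= t <= T) (tauP : ST t tau).

Let t0 : 0 <= t. Proof. by case/andP: t_range. Qed.

Definition level o := [set w | tau w = date o].

(** A date is attained exactly when it bounds the stopping time and no earlier
    date does; this uses that there are finitely many dates. *)
Lemma level_meas o : F (date o) (level o).
Proof.
case: (tauP) => -[tau0 tauF] tauS.
have /andP[v0 vT] := date_range o; set v := date o in v0 vT *.
apply/(measurable_gE (Fsig v0)).
have -> : level o = [set w | tau w <= v] `\`
    \bigcup_(p in [set p | date p < v]) [set w | tau w <= date p].
  apply/seteqP; split=> w /=.
    move=> tauE; split; first by rewrite tauE.
    by move=> [p pv]; rewrite /= tauE leNgt => /negP; apply.
  move=> [tauv Ntau]; apply/eqP; rewrite eq_le tauv leNgt; apply/negP => tau_v.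
  have [/dateP[p tauE] _] := tauS w.
  by apply: Ntau; exists p; rewrite /= -tauE.
apply: measurableD; first by apply/(measurable_gE (Fsig v0)); exact: tauF.
apply: fin_bigcup_measurable; first exact: finite_finset.
move=> p /= pv; apply/(measurable_gE (Fsig v0)).
have /andP[p0 _] := date_range p.
exact: Fsub (ltW pv) _ (tauF _ p0).
Qed.

Lemma level_measurable o : measurable (level o).
Proof.
have /andP[v0 _] := date_range o; exact: Fmeas v0 _ (level_meas o).
Qed.

Lemma stoppedE X : stopped X tau =
  fun w => \sum_o (X (date o) \_ (level o)) w.
Proof.
apply/funext => w; have [_ tauS] := tauP.
have [/dateP[q tauE] _] := tauS w.
rewrite (bigD1 q) //= patchE mem_set // big1 ?addr0 /stopped ?tauE //.
move=> p pq; rewrite patchE memNset // /level /= tauE => /date_inj.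
by move/esym/eqP; rewrite (negbTE pq).
Qed.

Lemma L1_stopped X : (forall o, L1 (X (date o))) -> L1 (stopped X tau).
Proof.
move=> iX; rewrite stoppedE; apply: L1_sum => o _.
by apply: L1_restrict => //; exact: level_measurable.
Qed.

Lemma integral_stopped X A : (forall o, L1 (X (date o))) -> measurable A ->
  (\int[Pr]_(w in A) (stopped X tau w)%:E =
   \sum_o \int[Pr]_(w in A `&` level o) (X (date o) w)%:E)%E.
Proof.
move=> iX mA; rewrite stoppedE.
under eq_integral do rewrite -sumEFin.
rewrite integral_sum //; last first.
  move=> o; apply: (integrableS measurableT) => //.
  by apply: L1_restrict => //; exact: level_measurable.
apply: eq_bigr => o _; rewrite integral_mkcondr.
by apply: eq_integral => w _; rewrite !patchE; case: ifP.
Qed.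

(** Split an event of [F t] according to the value of [tau]: the piece on which
    [tau] equals a given date lies in the sigma-algebra of that date, where
    [M] at the date may be replaced by [M T].  The constant process [M T] is
    split in the same way, so that both integrals agree piece by piece. *)
Lemma optional_stopping M : martingale Pr T F M ->
  is_condexp Pr (F t) (stopped M tau) (M t).
Proof.
move=> [Madapted _ Mint Mcond].
have iM o : L1 (M (date o)) by exact/Mint/date_range.
have /andP[_ tT] := t_range.
have T0 : 0 <= T by exact: le_trans tT.
have iT : L1 (M T) by apply: Mint; rewrite T0 lexx.
split; [exact: L1_stopped|exact: Madapted|exact: Mint|move=> A FA].
have mA : measurable A by exact: Fmeas FA.
have [_ _ _ ->//] := Mcond t T t0 tT (lexx T).
have -> : M T = stopped (fun=> M T) tau by [].
rewrite !integral_stopped //; apply: eq_bigr => q _.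
have /andP[q0 qT] := date_range q.
have [_ _ _ ->//] := Mcond _ _ q0 qT (lexx T).
have [early|late] := ltP (date q) t; last first.
  apply/(measurable_gE (Fsig q0)); apply: measurableI.
    apply/(measurable_gE (Fsig q0)); exact: Fsub late _ FA.
  by apply/(measurable_gE (Fsig q0)); exact: level_meas.
have -> : level q = set0.
  apply/seteqP; split => // w /= tauE; have [_ tauS] := tauP.
  have [_ /andP[+ _]] := tauS w.
  by rewrite tauE leNgt early.
by rewrite setI0; apply/(measurable_gE (Fsig q0)).
Qed.
End StoppingTime.

Section HittingTime.
Variables (K : pred 'I_N.+1) (b : 'I_N.+1 -> set Omega).

(** The first date [s k] with [K k] at which the event [b k] occurs, or [T]. *)
Definition hitting w := \big[Num.min/T]_(k | K k && (w \in b k)) s k.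

Lemma hittingP w : exists2 o, hitting w = date o &
  (if o is Some k then K k /\ b k w else True) /\
  forall k, K k -> s k < date o -> ~ b k w.
Proof.
have first k : K k -> s k < hitting w -> ~ b k w.
  move=> Kk + bk; rewrite ltNge => /negP; apply.
  by apply: bigmin_le_cond; rewrite Kk mem_set.
have [/existsP[k Kbk]|none] := boolP [exists k, K k && (w \in b k)].
  have [|j] := @eq_bigmin _ _ _ T k (fun k => K k && (w \in b k)) s Kbk.
    by move=> i _; rewrite ltW ?date_ltT.
  rewrite /in_mem /= => /andP[Kj /set_mem bj] hE.
  by exists (Some j) => //; split => // i; rewrite -[date _]hE; exact: first.
exists None; last first.
  split=> // k Kk _ bk; move/existsP: none; apply; exists k.
  by rewrite Kk mem_set.
rewrite /hitting big_pred0 // => k; apply/negbTE/negP => Kbk.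
by move/existsP: none; apply; exists k.
Qed.

Lemma hitting_stopping (t : R) : 0 <= t <= T -> (forall k, K k -> t <= s k) ->
  (forall k, F (s k) (b k)) -> ST t hitting.
Proof.
move=> /andP[t0 tT] Kt Fb; split; last first.
  move=> w; have [q -> [qK _]] := hittingP w.
  split; first by apply/dateP; exists q.
  have /andP[_ ->] := date_range q; rewrite andbT.
  by case: q qK => [k [/Kt]|].
split=> [w|u u0].
  by have [q -> _] := hittingP w; have /andP[] := date_range q.
apply/(measurable_gE (Fsig u0)).
have [Tu|uT] := leP T u.
  rewrite (_ : [set _ | _] = setT) //; apply/seteqP; split => // w _ /=.
  by have [q -> _] := hittingP w; have /andP[_ /le_trans] := date_range q; apply.
rewrite (_ : [set _ | _] = \bigcup_(k in [set k | K k && (s k <= u)]) b k).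
  apply: fin_bigcup_measurable; first exact: finite_finset.
  move=> k /= /andP[_ ku]; apply/(measurable_gE (Fsig u0)).
  exact: Fsub (date_ge0 k) ku _ (Fb k).
apply/seteqP; split=> w /=.
  move=> /bigmin_leP[|[k /andP[Kk /set_mem bk] ku]].
    by rewrite leNgt uT.
  by exists k => //=; rewrite Kk.
move=> [k /= /andP[Kk ku] bk]; apply/bigmin_leP; right; exists k => //.
by rewrite Kk mem_set.
Qed.
End HittingTime.
End Stopping.

(** * Pathwise inequalities along a trajectory *)

(** One trajectory is fixed: [p k], [c k] and [m k] stand for the payoff, the
    continuation value and the martingale at the date of index [k], and [pT],
    [mT] for the payoff and the martingale at maturity. *)
Section Pathwise.
Context {R : realType}.
Variables (N : nat) (lambda pT mT : R) (p c m : 'I_N.+1 -> R).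
Hypothesis lambda_gt0 : 0 < lambda.

(** The amount by which the regularised value exceeds the continuation value at
    a date: [c k + increment k] is the regularised value there. *)
Definition increment k := lambda * Phi ((p k - c k) / lambda).

(** The regularised value minus the martingale, at any time whose remaining dates
    are those in [K]; subtracting the martingale leaves a process that only
    moves at exercise dates. *)
Definition compensated (K : pred 'I_N.+1) := pT - mT + \sum_(k | K k) increment k.

Hypothesis cE : forall i, c i = compensated (fun k => i < k)%N + m i.
Variable K : pred 'I_N.+1.
Hypothesis K_up : forall i j : 'I_N.+1, K i -> (i <= j)%N -> K j.

Lemma compensated_split k : K k ->
  compensated K = \sum_(i | K i && (i < k)%N) increment i
           + (c k + increment k - m k).
Proof.
move=> Kk; rewrite cE /compensated (bigID (fun i : 'I_N.+1 => (i < k)%N)) /=.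
rewrite [X in _ + (_ + X)](bigD1 k) /=; last by rewrite Kk ltnn.
suff -> : \sum_(i < N.+1 | (K i && ~~ (i < k)%N) && (i != k)) increment i =
    \sum_(i < N.+1 | (k < i)%N) increment i by lra.
apply: eq_bigl => i; rewrite -leqNgt ltn_neqAle andbC [in RHS]eq_sym.
have [ki|] := boolP (k <= i)%N; last by rewrite !andbF.
by rewrite (K_up Kk ki).
Qed.

Let pe (o : option 'I_N.+1) := oapp p pT o.
Let me (o : option 'I_N.+1) := oapp m mT o.
Let before (o : option 'I_N.+1) (i : 'I_N.+1) :=
  if o is Some k then (i < k)%N else true.

(** As long as the payoff is below the continuation value the increments are
    non-positive, and at the first date where it is above, the regularised value
    is at most the payoff. *)
Lemma compensated_le_stopped o :
  (if o is Some k then K k /\ c k <= p k else True) ->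
  (forall i, K i -> before o i -> p i <= c i) -> compensated K <= pe o - me o.
Proof.
have neg i : p i <= c i -> increment i <= 0.
  move=> pc.
  have /andP[_] := @regularised_max_between _ lambda (p i) (c i) lambda_gt0.
  by rewrite max_r // -/(increment i) gerDl.
case: o => [k [Kk ck]|_] H /=; last first.
  rewrite /compensated gerDl sumr_le0 // => i Ki; apply: neg; exact: H.
rewrite (compensated_split Kk).
have : \sum_(i | K i && (i < k)%N) increment i <= 0.
  by apply: sumr_le0 => i /andP[Ki ik]; apply: neg; exact: H.
have /andP[_] := @regularised_max_between _ lambda (p k) (c k) lambda_gt0.
rewrite max_l // -/(increment k); lra.
Qed.

(** The mirror image: while the payoff is above the continuation value the
    increments are non-negative, and at the first date where it is below, the
    regularised value is at least the payoff. *)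
Lemma stopped_le_compensated o :
  (if o is Some k then K k /\ p k <= c k else True) ->
  (forall i, K i -> before o i -> c i <= p i) -> pe o - me o <= compensated K.
Proof.
have pos i : c i <= p i -> 0 <= increment i.
  move=> cp.
  have /andP[+ _] := @regularised_max_between _ lambda (p i) (c i) lambda_gt0.
  by rewrite min_r // -/(increment i) lerDl.
case: o => [k [Kk ck]|_] H /=; last first.
  rewrite /compensated lerDl sumr_ge0 // => i Ki; apply: pos; exact: H.
rewrite (compensated_split Kk).
have : 0 <= \sum_(i | K i && (i < k)%N) increment i.
  by apply: sumr_ge0 => i /andP[Ki ik]; apply: pos; exact: H.
have /andP[+ _] := @regularised_max_between _ lambda (p k) (c k) lambda_gt0.
rewrite min_l // -/(increment k); lra.
Qed.

(** For an arbitrary exercise date: replacing the maximum of payoff and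
    continuation value by its soft version loses the gap at each date up to
    exercise, and nothing else decreases the right-hand side because every gap
    plus its increment is non-negative. *)
Lemma stopped_le_compensated_gap o : (if o is Some k then K k else true) ->
  pe o - me o <=
  compensated K + \sum_(k | K k) (Num.max (p k) (c k) - (c k + increment k)).
Proof.
set gap := fun k => Num.max (p k) (c k) - (c k + increment k).
have gap0 k : 0 <= gap k.
  have /andP[_] := @regularised_max_between _ lambda (p k) (c k) lambda_gt0.
  by rewrite subr_ge0.
have gapN k : 0 <= gap k + increment k.
  have : c k <= Num.max (p k) (c k) by rewrite le_max lexx orbT.
  rewrite /gap; lra.
have sum0 (Q : pred 'I_N.+1) : 0 <= \sum_(k | Q k) (gap k + increment k).
  by apply: sumr_ge0 => k _.
case: o => [k Kk|_] /=; last first.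
  by rewrite /compensated -addrA lerDl addrC -big_split.
rewrite (compensated_split Kk) (bigID (fun i : 'I_N.+1 => (i < k)%N) K gap) /=.
have := sum0 (fun i => K i && (i < k)%N); rewrite big_split /=.
rewrite [X in _ <= _ + (_ + X)](bigD1 k) /=; last by rewrite Kk ltnn.
have : 0 <= \sum_(i < N.+1 | (K i && ~~ (i < k)%N) && (i != k)) gap i.
  by apply: sumr_ge0 => i _.
have : p k <= Num.max (p k) (c k) by rewrite le_max lexx.
have : gap k = Num.max (p k) (c k) - (c k + increment k) by [].
lra.
Qed.

End Pathwise.

(** * Continuation values of the regularised problem *)

Section Completeness.
Context {d : measure_display} {Omega : measurableType d} {R : realType}.
Variables (Pr : probability Omega R) (F : R -> set (set Omega)).
Hypotheses (F_filtration : filtration F) (F_usual : usual_conditions Pr F).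
Implicit Types X Y : Omega -> R.

(** [F t] contains all null sets. *)
Lemma measurable_wrt_ae t X Y : 0 <= t -> {ae Pr, forall w, X w = Y w} ->
  measurable_wrt (F t) Y -> measurable_wrt (F t) X.
Proof.
move=> t0 XY; have [/(_ _ t0) sigmaF _ Fsub] := F_filtration.
move=> /(measurable_wrtP sigmaF) mY; apply/(measurable_wrtP sigmaF) => B mB.
have null A : Pr.-negligible A -> F t A.
  by move=> A0; apply: (Fsub 0) => //; case: F_usual => _; exact.
pose D := [set w | X w <> Y w].
rewrite (_ : X @^-1` B = (Y @^-1` B `\` D) `|` (X @^-1` B `&` D)).
  apply/(measurable_gE sigmaF); apply: measurableU.
    apply: measurableD; apply/(measurable_gE sigmaF); first exact: mY.
    exact: null.
  apply/(measurable_gE sigmaF); apply: null.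
  by apply: negligibleS XY; exact: subIsetr.
apply/seteqP; split => w /=.
  move=> BX; have [XYw|XYw] := pselect (X w = Y w); last by right.
  by left; split; [rewrite -XYw|exact].
by move=> [[BY /contrapT ->]//|[]].
Qed.

Lemma measurable_wrt_right t u X : 0 <= t -> t < u ->
  (forall v, t < v <= u -> measurable_wrt (F v) X) -> measurable_wrt (F t) X.
Proof.
move=> t0 tu mX; have [sigmaF _ Fsub] := F_filtration.
apply/(measurable_wrtP (sigmaF _ t0)) => B mB.
case: F_usual => + _; apply => // v /=; rewrite in_itv /= andbT => tv.
have [vu|/ltW uv] := leP v u.
  have v0 : 0 <= v by rewrite (le_trans t0) ?ltW.
  by apply: (measurable_wrtP (sigmaF _ v0) X).1 => //; apply: mX; rewrite tv.
have u0 : 0 <= u by rewrite (le_trans t0) ?ltW.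
apply: (Fsub u) => //; apply: (measurable_wrtP (sigmaF _ u0) X).1 => //.
by apply: mX; rewrite tu /=.
Qed.
End Completeness.

Section Continuation.
Context {d : measure_display} {Omega : measurableType d} {R : realType}.
Variables (Pr : probability Omega R) (F : R -> set (set Omega)) (T : R).
Variables (N : nat) (s : 'I_N.+1 -> R) (P Vl Ml : R -> Omega -> R) (lambda : R).
Hypotheses (F_filtration : filtration F) (F_usual : usual_conditions Pr F).
Hypothesis s_dates : exercise_dates T s.
Hypothesis Vl_value : regularised_value Pr T F s P lambda Vl Ml.

Local Notation L1 X := (Pr.-integrable setT (EFin \o X)).

Definition compensated_at (C : 'I_N.+1 -> Omega -> R) (w : Omega) :=
  compensated lambda (P T w) (Ml T w) (fun k => P (s k) w) (C ^~ w).

Lemma regularised_value_integrable u : 0 <= u <= T -> L1 (Vl u).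
Proof.
move=> /andP[u0 uT]; have [[_ Vl_ui] _ _ _] := Vl_value.
apply: uniformly_integrable_L1 Vl_ui _.
have [sigmaF _ _] := F_filtration.
exists (cst u) => //; split=> [|w /=] //; split=> // v v0.
apply/(measurable_gE (sigmaF _ v0)) => /=.
have [uv|vu] := leP u v.
  by rewrite (_ : [set _ | _] = setT) //; apply/seteqP; split.
by rewrite (_ : [set _ | _] = set0) //; apply/seteqP; split.
Qed.

(** Between two consecutive dates Vl - Ml does not move, so that the right limit
    of Vl at [s i] is Vl u - Ml u + Ml (s i) for every [u] in that interval.
    Taking one such [u] makes the continuation value everywhere defined and
    integrable; letting [u] decrease to [s i] makes it measurable at [s i], by
    right continuity of the filtration. *)
Lemma continuation_value_exists : exists C : 'I_N.+1 -> Omega -> R,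
  [/\ forall i, measurable_wrt (F (s i)) (C i),
      forall i, L1 (C i) &
      {ae Pr, forall w,
        (forall i, C i w = compensated_at C w (fun k => i < k)%N + Ml (s i) w) /\
        forall u, 0 <= u <= T ->
          Vl u w = compensated_at C w (fun k => u <= s k) + Ml u w}].
Proof.
have [[Vl_adapted _] [[Ml_adapted Ml_cadlag Ml_int _] _] _ Vl_eq] := Vl_value.
pose next i := \big[Num.min/T]_(k < N.+1 | (i < k)%N) s k.
have lt_next i : s i < next i.
  apply/bigmin_gtP; split; first exact: date_ltT s_dates _.
  by move=> k ik; rewrite (date_lt s_dates).
have date_next i u : s i < u <= next i -> forall k, (u <= s k) = (i < k)%N.
  move=> /andP[iu /bigmin_geP[_ un]] k; apply/idP/idP => [uk|/un//].
  by rewrite -(date_lt s_dates) (lt_le_trans iu).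
have range_next i u : s i < u <= next i -> 0 <= u <= T.
  move=> /andP[iu /bigmin_geP[uT _]]; rewrite uT andbT.
  by rewrite (le_trans (date_ge0 s_dates i)) ?ltW.
pose mid i := (s i + next i) / 2.
have midP i : s i < mid i <= next i.
  by have := lt_next i; rewrite /mid => h; apply/andP; split; lra.
pose C i w := Vl (mid i) w - Ml (mid i) w + Ml (s i) w.
have s_range i : 0 <= s i <= T.
  by rewrite (date_ge0 s_dates) ltW ?(date_ltT s_dates).
have Ceq : {ae Pr, forall w,
    (forall i, C i w = compensated_at C w (fun k => i < k)%N + Ml (s i) w) /\
    forall u, 0 <= u <= T ->
      Vl u w = compensated_at C w (fun k => u <= s k) + Ml u w}.
  apply: filterS Vl_eq => w Vl_eq.
  pose rl i := right_limit Vl (s i) w.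
  pose tl := compensated lambda (P T w) (Ml T w) (fun k => P (s k) w) rl.
  have VlE u : 0 <= u <= T -> Vl u w = tl (fun k => u <= s k) + Ml u w.
    move=> uT; rewrite Vl_eq // /tl /compensated /increment.
    under eq_bigl do rewrite (date_ltT s_dates) andbT.
    by lra.
  have VlE' i u : s i < u <= next i ->
      Vl u w = tl (fun k => i < k)%N + Ml u w.
    move=> iu; rewrite VlE ?(range_next i) // /tl /compensated.
    by under eq_bigl do rewrite (date_next _ _ iu).
  have CE i : C i w = tl (fun k => i < k)%N + Ml (s i) w.
    by rewrite /C (VlE' i) // addrK.
  (* the right limits in the equation of Vl are identified with C *)
  have rlE : rl = C ^~ w.
    apply/funext => i; rewrite CE; apply/cvg_lim => //.
    apply: (@cvg_trans _ (tl (fun k => i < k)%N + Ml u w @[u --> (s i)^'+])).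
      apply: near_eq_cvg; near=> u; apply/esym/VlE'; apply/andP; split.
        by near: u; exact: nbhs_right_gt.
      by near: u; exact: nbhs_right_le.
    apply: cvgD; first exact: cvg_cst.
    have [+ _] := Ml_cadlag w; apply.
    by rewrite (date_ge0 s_dates) (date_ltT s_dates).
  by split=> [i|u uT]; rewrite ?CE ?VlE // /tl rlE.
exists C; split => // i; last first.
  apply: L1D; last exact: Ml_int.
  apply: L1B; last exact/Ml_int/(range_next i).
  exact/regularised_value_integrable/(range_next i).
apply: (measurable_wrt_right F_filtration F_usual (date_ge0 s_dates i)
  (lt_next i)).
move=> v iv; have /andP[v0 vT] := range_next _ _ iv.
apply: (measurable_wrt_ae F_filtration F_usual v0
  (Y := fun w => Vl v w - Ml v w + Ml (s i) w)).
  apply: filterS Ceq => w [CE VlE]; rewrite CE VlE ?v0 //.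
  rewrite addrK /compensated_at /compensated.
  by under [in RHS]eq_bigl do rewrite (date_next _ _ iv).
apply: measurable_funD.
  by apply: measurable_funB; [apply: Vl_adapted|apply: Ml_adapted]; rewrite v0.
have [sigmaF _ Fsub] := F_filtration.
apply/(measurable_wrtP (sigmaF _ v0)) => B mB.
apply: (Fsub (s i)); [exact: date_ge0 s_dates i|by case/andP: iv => /ltW|].
apply: (measurable_wrtP (sigmaF _ (date_ge0 s_dates i)) _).1 => //.
exact: Ml_adapted.
Unshelve. all: by end_near.
Qed.
End Continuation.

(** * Comparison of the two value processes *)

(** The largest index of a date before [t] bounds from below the index of every
    date from [t] on.  Before the first date this index is 0 by convention, and
    all N + 1 dates are counted. *)
Lemma card_remaining {R : realType} (T : R) (N : nat) (s : 'I_N.+1 -> R) (t : R) :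
  exercise_dates T s -> (#|[pred k | (t <= s k)%R]| <= remaining_dates s t)%N.
Proof.
move=> s_dates; rewrite /remaining_dates -sum1_card; set j := \max_(i < _ | _) i.
have -> : (N.+1 - j = \sum_(k < N.+1 | j <= k) 1)%N.
  by rewrite -(big_geq_mkord j N.+1 xpredT (fun=> 1%N)) sum_nat_const_nat muln1.
rewrite [leqLHS](eq_bigl (fun k => t <= s k)) //.
rewrite [leqLHS]big_mkcond [leqRHS]big_mkcond.
apply: leq_sum => k _; case: ifPn => // tk.
rewrite ifT //; apply/bigmax_leqP => i it.
by rewrite ltnW // -(date_lt s_dates) (lt_le_trans it).
Qed.

Section Main.
Context {d : measure_display} {Omega : measurableType d} {R : realType}.
Variables (Pr : probability Omega R) (F : R -> set (set Omega)) (T : R).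
Variables (N : nat) (s : 'I_N.+1 -> R) (P V Vl Ml : R -> Omega -> R) (lambda : R).
Hypotheses (F_filtration : filtration F) (F_usual : usual_conditions Pr F).
Hypothesis s_dates : exercise_dates T s.
Hypothesis P_adapted : adapted T F P.
Hypothesis P_ge0 : forall u w, 0 <= u <= T -> 0 <= P u w.
Hypothesis P_integrable :
  forall u, (range s `|` [set T]) u -> ('E_Pr[P u] < +oo)%E.
Hypothesis V_value : value_process Pr T F (range s) P V.
Hypotheses (lambda_gt0 : 0 < lambda) (lambda_lt1 : lambda < 1).
Hypothesis Vl_value : regularised_value Pr T F s P lambda Vl Ml.

Variable C : 'I_N.+1 -> Omega -> R.
Hypothesis C_measurable : forall i, measurable_wrt (F (s i)) (C i).
Hypothesis C_integrable : forall i, Pr.-integrable setT (EFin \o C i).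
Hypothesis C_eq : {ae Pr, forall w,
  (forall i, C i w =
     compensated_at T s P Ml lambda C w (fun k => i < k)%N + Ml (s i) w) /\
  forall u, 0 <= u <= T ->
    Vl u w = compensated_at T s P Ml lambda C w (fun k => u <= s k) + Ml u w}.

Local Notation L1 X := (Pr.-integrable setT (EFin \o X)).
Local Notation ST := (stopping_times T F (range s)).
Local Notation date := (date T s).
Local Notation compensated_at := (compensated_at T s P Ml lambda C).

Let Fsig (t : R) : 0 <= t <= T -> sigma_algebra setT (F t).
Proof. by move=> /andP[t0 _]; case: F_filtration => + _ _; exact. Qed.

Let Fmeas (t : R) : 0 <= t <= T -> F t `<=` measurable.
Proof. by move=> /andP[t0 _]; case: F_filtration => _ + _; exact. Qed.

Let Ml_mart : martingale Pr T F Ml.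
Proof. by case: Vl_value => _ []. Qed.

Let date_in := date_range s_dates.

Let s_range i : 0 <= s i <= T := date_in (Some i).

Lemma payoff_integrable o : L1 (P (date o)).
Proof.
have /= := date_in o => /[dup] o_range /P_adapted.
move=> /(measurable_wrt_measurable (Fsig o_range) (Fmeas o_range)) mP.
apply/integrableP; split; first exact/measurable_EFinP.
have /P_integrable : (range s `|` [set T]) (date o).
  by apply/dateP; exists o.
rewrite unlock; apply: le_lt_trans.
under eq_integral do rewrite gee0_abs ?lee_fin ?P_ge0 //.
by [].
Qed.

Let stopped_payoff_integrable t tau : 0 <= t <= T -> ST t tau ->
  L1 (stopped P tau).
Proof.
by move=> tT tauP; apply: (L1_stopped F_filtration s_dates tauP) => o;
  exact: payoff_integrable.
Qed.

Lemma condexp_le_value t tau : 0 <= t <= T -> ST t tau ->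
  {ae Pr, forall w, condexp Pr (F t) (stopped P tau) w <= V t w}.
Proof.
by move=> tT tauP; have [_ + _] := V_value tT; apply; exists tau.
Qed.

(** A general starting point for the pathwise inequalities: [X] is the regularised
    value at a time [u], or its right limit there, and [K] the set of dates that
    remain. *)
Section Bracket.
Variables (u : R) (K : pred 'I_N.+1) (X : Omega -> R).
Hypotheses (u_range : 0 <= u <= T) (K_ge : forall k, K k -> u <= s k).
Hypothesis K_up : forall i j : 'I_N.+1, K i -> (i <= j)%N -> K j.
Hypotheses (X_meas : measurable_wrt (F u) X) (X_int : L1 X).
Hypothesis X_eq : {ae Pr, forall w, X w = compensated_at w K + Ml u w}.

Let MlP tau : ST u tau ->
  is_condexp Pr (F u)
    (fun w => stopped P tau w - stopped Ml tau w + Ml u w)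
    (fun w => condexp Pr (F u) (stopped P tau) w - Ml u w + Ml u w).
Proof.
move=> tauP; have [Ml_adapted _ Ml_int _] := Ml_mart.
apply: (is_condexpD (Fmeas u_range)).
  apply: (is_condexpB (Fmeas u_range)).
    apply: (condexpP (Fsig u_range) (Fmeas u_range)).
    exact: stopped_payoff_integrable tauP.
  exact: (optional_stopping F_filtration s_dates u_range tauP Ml_mart).
by apply: is_condexp_id; [exact: Ml_int|exact: Ml_adapted].
Qed.

Let payoff_ge_meas k : F (s k) [set w | C k w <= P (s k) w].
Proof.
have sk := s_range k; apply/(measurable_gE (Fsig sk)).
rewrite -[X in measurable X]setTI; apply: measurable_fun_ler => //.
  exact: C_measurable.
exact: P_adapted.
Qed.

Let payoff_le_meas k : F (s k) [set w | P (s k) w <= C k w].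
Proof.
have sk := s_range k; apply/(measurable_gE (Fsig sk)).
rewrite -[X in measurable X]setTI; apply: measurable_fun_ler => //.
  exact: P_adapted.
exact: C_measurable.
Qed.

(** Exercise at the first remaining date where the payoff reaches the continuation
    value; the martingale drops out by optional stopping. *)
Lemma compensated_le_value : {ae Pr, forall w, X w <= V u w}.
Proof.
pose tau := hitting T s K (fun k => [set w | C k w <= P (s k) w]).
have tauP : ST u tau by exact: (hitting_stopping F_filtration s_dates).
apply: filterS2 (condexp_le_value u_range tauP)
  (is_condexp_le (Fsig u_range) (Fmeas u_range)
    (is_condexp_id X_int X_meas) (MlP tauP) _).
  by move=> w; rewrite subrK => /[swap]; exact: le_trans.
apply: filterS2 X_eq C_eq => w -> [CE _]; rewrite lerD2r /stopped /tau.
have [q -> [qK qfirst]] := hittingP s_dates K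
  (fun k => [set w | C k w <= P (s k) w]) w.
apply: le_trans (compensated_le_stopped lambda_gt0 CE K_up (o := q) _ _) _.
- by case: q qK {qfirst}.
- move=> i Ki iq; rewrite leNgt; apply/negP => /ltW; apply: qfirst => //.
  by case: q {qK} iq => [k|] /= iq; rewrite ?(date_lt s_dates) ?(date_ltT s_dates).
- by case: q {qK qfirst}.
Qed.

(** Exercise at the first remaining date where the payoff does not exceed the
    continuation value. *)
Lemma compensated_ge0 : {ae Pr, forall w, 0 <= X w}.
Proof.
pose tau := hitting T s K (fun k => [set w | P (s k) w <= C k w]).
have tauP : ST u tau by exact: (hitting_stopping F_filtration s_dates).
have P0 : {ae Pr, forall w, 0 <= condexp Pr (F u) (stopped P tau) w}.
  apply: (is_condexp_ge0 (Fsig u_range) (Fmeas u_range)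
    (condexpP (Fsig u_range) (Fmeas u_range)
      (stopped_payoff_integrable u_range tauP))).
  apply: aeW => w; apply: P_ge0; have [_ tauS] := tauP.
  have [_ /andP[ut ->]] := tauS w; rewrite andbT.
  by apply: le_trans ut; case/andP: u_range.
apply: filterS2 P0
  (is_condexp_le (Fsig u_range) (Fmeas u_range)
    (MlP tauP) (is_condexp_id X_int X_meas) _).
  by move=> w; rewrite subrK; exact: le_trans.
apply: filterS2 X_eq C_eq => w -> [CE _]; rewrite lerD2r /stopped /tau.
have [q -> [qK qfirst]] := hittingP s_dates K
  (fun k => [set w | P (s k) w <= C k w]) w.
apply: le_trans (stopped_le_compensated lambda_gt0 CE K_up (o := q) _ _).
- by case: q {qK qfirst}.
- by case: q qK {qfirst}.
- move=> i Ki iq; rewrite leNgt; apply/negP => /ltW; apply: qfirst => //.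
  by case: q {qK} iq => [k|] /= iq; rewrite ?(date_lt s_dates) ?(date_ltT s_dates).
Qed.
End Bracket.

Lemma continuation_between i : {ae Pr, forall w, 0 <= C i w <= V (s i) w}.
Proof.
have Ceq : {ae Pr, forall w,
    C i w = compensated_at w (fun k => i < k)%N + Ml (s i) w}.
  by apply: filterS C_eq => w [].
have K_ge (k : 'I_N.+1) : (i < k)%N -> s i <= s k.
  by rewrite -(date_lt s_dates) => /ltW.
have K_up (j k : 'I_N.+1) : (i < j)%N -> (j <= k)%N -> (i < k)%N.
  by move=> /leq_trans; apply.
have := compensated_ge0 (s_range i) K_ge K_up (@C_measurable i)
  (C_integrable i) Ceq.
have := compensated_le_value (s_range i) K_ge K_up (@C_measurable i)
  (C_integrable i) Ceq.
by apply: filterS2 => w -> ->.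
Qed.

(** Compare with immediate exercise. *)
Lemma payoff_le_value i : {ae Pr, forall w, P (s i) w <= V (s i) w}.
Proof.
have si := s_range i.
have st : ST (s i) (cst (s i)).
  have := @hitting_stopping _ _ _ F T N s F_filtration s_dates (pred1 i)
    (fun=> setT) (s i) si.
  rewrite (_ : hitting _ _ _ _ = cst (s i)); last first.
    apply/funext => w; rewrite /hitting (bigD1 i) /= ?eqxx ?in_setT //.
    rewrite big_pred0 ?min_l ?ltW ?(date_ltT s_dates) // => k.
    by case: (k == i).
  apply; first by move=> k /eqP ->.
  by move=> k; apply/(measurable_gE (Fsig (s_range k))).
apply: filterS2 (condexp_le_value si st)
  (is_condexp_le (Fsig si) (Fmeas si)
    (is_condexp_id (payoff_integrable (Some i)) (P_adapted si))
    (condexpP (Fsig si) (Fmeas si) (stopped_payoff_integrable si st)) _).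
  by move=> w /[swap]; exact: le_trans.
exact: aeW.
Qed.

(** Every stopped payoff is at most the sum of the payoffs over all dates. *)
Lemma value_integrable i : L1 (V (s i)).
Proof.
have si := s_range i.
pose S w := \sum_o P (date o) w.
have iS : L1 S by apply: L1_sum => o _; exact: payoff_integrable.
have [mV _ Vleast] := V_value si.
have [_ mE iE _] := condexpP (Fsig si) (Fmeas si) iS.
apply: (L1_ae_bound mV iE).
have VS : {ae Pr, forall w, V (s i) w <= condexp Pr (F (s i)) S w}.
  apply: Vleast.
    exact: (measurable_wrt_measurable (Fsig si) (Fmeas si) mE).
  move=> _ [tau st <-].
  apply: (is_condexp_le (Fsig si) (Fmeas si)
    (condexpP (Fsig si) (Fmeas si) (stopped_payoff_integrable si st))
    (condexpP (Fsig si) (Fmeas si) iS)).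
  apply: aeW => w; have [_ tauS] := st.
  have [/dateP[q tauE] _] := tauS w.
  rewrite /stopped tauE /S (bigD1 q) //= lerDl sumr_ge0 // => p _.
  by rewrite P_ge0.
apply: filterS2 VS (payoff_le_value i) => w VSw PV.
by rewrite ger0_norm // (le_trans _ PV) // P_ge0.
Qed.

Section Estimate.
Variable t : R.
Hypothesis t_range : 0 <= t <= T.

Let K : pred 'I_N.+1 := fun k => t <= s k.
Let logmax w := ln (Num.max (running_max T s V t w) 1).
Let C0 : R := - ln (1 - expR (-1)).
Let rate : R := lambda - lambda * ln lambda.

Let C0_ge0 : 0 <= C0.
Proof. by rewrite oppr_ge0 ln_le0 // gerBl expR_ge0. Qed.

Let rate_ge0 : 0 <= rate.
Proof.
rewrite subr_ge0 (@le_trans _ _ 0) ?(ltW lambda_gt0) //.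
by rewrite pmulr_rle0 // ln_le0 // ltW.
Qed.

Let logmax_ge0 w : 0 <= logmax w.
Proof. by rewrite ln_ge0 // le_max lexx orbT. Qed.

Lemma logmax_integrable : L1 logmax.
Proof.
pose W w := \sum_i `|V (s i) w| + 1.
have iW : L1 W.
  apply: L1D; last exact: L1_cst.
  apply: L1_sum => i _; have := value_integrable i.
  by move=> /integrable_abse.
apply: (L1_ae_bound _ iW).
  apply: measurableT_comp; first exact: measurable_ln.
  apply: measurable_maxr => //; rewrite /running_max.
  elim: (index_enum _) => [|i r IH].
    under eq_fun do rewrite big_nil. exact: measurable_cst.
  under eq_fun do rewrite big_cons.
  case: (t <= s i < T) => //; apply: measurable_maxr => //.
  by have [] := V_value (s_range i).
apply: aeW => w; rewrite ger0_norm ?logmax_ge0 //.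
have m0 : 0 < Num.max (running_max T s V t w) 1 by rewrite lt_max ltr01 orbT.
apply: (le_trans (ltW (ln_sublinear m0))).
have W0 : 0 <= \sum_i `|V (s i) w| by apply: sumr_ge0.
rewrite /W ge_max; apply/andP; split; last by rewrite lerDr.
apply: (@le_trans _ _ (\sum_i `|V (s i) w|)); last by rewrite lerDl.
apply/bigmax_leP; split => // i _; rewrite (le_trans (ler_norm _)) //.
by rewrite (bigD1 i) //= lerDl sumr_ge0.
Qed.

(** Payoff and continuation value both lie in [0, V (s k)], hence so does the
    absolute value of their difference, which is therefore at most the running
    maximum. *)
Lemma gap_le : {ae Pr, forall w, forall k, K k ->
  Num.max (P (s k) w) (C k w)
    - (C k w + increment lambda (fun k => P (s k) w) (C ^~ w) k) <=
  (1 + C0 + logmax w) * rate}.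
Proof.
have : {ae Pr, forall w, forall k,
    0 <= C k w <= V (s k) w /\ P (s k) w <= V (s k) w}.
  apply: filter_forall => k.
  by apply: filterS2 (continuation_between k) (payoff_le_value k).
apply: filterS => w bounds k Kk; have [/andP[c0 cV] pV] := bounds k.
have p0 := P_ge0 w (s_range k).
apply: (le_trans (regularised_max_gap _ _ lambda_gt0 lambda_lt1)).
have l0 : ln lambda < 0 by rewrite ln_lt0 // lambda_gt0.
have Vmax : V (s k) w <= running_max T s V t w.
  by apply: le_bigmax_cond; rewrite (date_ltT s_dates) andbT.
have lnL : ln (Num.max `|P (s k) w - C k w| 1) <= logmax w.
  rewrite ler_ln ?posrE ?lt_max ?ltr01 ?orbT //.
  rewrite ge_max !le_max lexx orbT andbT; apply/orP; left.
  by rewrite (le_trans _ Vmax) // ler_norml; apply/andP; split; lra.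
have L0 := logmax_ge0 w.
rewrite -/C0 /rate; move: (ln lambda) l0 (logmax w) L0 lnL => l l0 L L0.
move: (ln _) => q qL.
have h1 : lambda * (C0 - l + q) <= lambda * (C0 - l + L)
  by rewrite ler_pM2l // lerD2l.
(* the two sides of the final comparison differ by lambda plus this product *)
have h2 : 0 <= lambda * - l * (C0 + L).
  by rewrite mulr_ge0 ?addr_ge0 // mulr_ge0 ?oppr_ge0 ?(ltW l0) ?(ltW lambda_gt0).
have -> : (1 + C0 + L) * (lambda - lambda * l) =
  lambda * (C0 - l + L) + lambda + lambda * - l * (C0 + L) by ring.
by apply: (le_trans h1); rewrite -[leRHS]addrA lerDl addr_ge0 // ltW.
Qed.

Lemma stopped_payoff_le tau : ST t tau -> {ae Pr, forall w,
  stopped P tau w - stopped Ml tau w + Ml t w <=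
  Vl t w + (remaining_dates s t)%:R * (1 + C0 + logmax w) * rate}.
Proof.
move=> st.
apply: filterS2 gap_le C_eq => w gapw [CE VlE].
rewrite VlE // [leRHS]addrAC lerD2r.
have [_ tauS] := st; have [/dateP[q tauE] /andP[tq _]] := tauS w.
have K_up (i j : 'I_N.+1) : K i -> (i <= j)%N -> K j.
  by rewrite -(date_le s_dates) => /le_trans; apply.
rewrite tauE in tq; rewrite /stopped tauE.
have := stopped_le_compensated_gap lambda_gt0 CE K_up (o := q).
have -> : oapp (fun k => P (s k) w) (P T w) q = P (date q) w by case: q {tauE tq}.
have -> : oapp (fun k => Ml (s k) w) (Ml T w) q = Ml (date q) w by case: q {tauE tq}.
move=> /(_ _)/le_trans; apply; first by case: q {tauE} tq.
rewrite lerD2l (le_trans (ler_sum _ gapw)) // sumr_const.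
rewrite -[leLHS]mulr_natl -[leRHS]mulrA.
apply: ler_wpM2r; last by rewrite ler_nat; exact: card_remaining s_dates.
by rewrite mulr_ge0 ?rate_ge0 // !addr_ge0.
Qed.

(** The essential supremum is at most the conditional expectation of the pathwise
    bound, which does not depend on the stopping time. *)
Lemma value_gap_le : {ae Pr, forall w,
  V t w - Vl t w <= (remaining_dates s t)%:R
    * (1 - ln (1 - expR (-1)) + condexp Pr (F t) logmax w) * rate}.
Proof.
have [[Vl_adapted _] _ _ _] := Vl_value.
have [Ml_adapted _ Ml_int _] := Ml_mart.
have FS := Fsig t_range; have FM := Fmeas t_range.
have iVl := regularised_value_integrable F_filtration Vl_value t_range.
pose n : R := (remaining_dates s t)%:R.
pose bound (L : Omega -> R) w := Vl t w + (n * (1 + C0) * rate + n * rate * L w).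
have boundE : is_condexp Pr (F t) (bound logmax)
    (bound (condexp Pr (F t) logmax)).
  apply: (is_condexpD FM); first exact: (is_condexp_id iVl (Vl_adapted _ t_range)).
  apply: (is_condexpD FM).
    by apply: is_condexp_id; [exact: L1_cst|exact: measurable_cst].
  apply: (is_condexpZ FM); exact: (condexpP FS FM logmax_integrable).
have [_ mB _ _] := boundE.
have [_ _ Vleast] := V_value t_range.
have : {ae Pr, forall w, V t w <= bound (condexp Pr (F t) logmax) w}.
  apply: Vleast; first exact: (measurable_wrt_measurable FS FM mB).
  move=> _ [tau st <-].
  have E := is_condexpD FM (is_condexpB FM
    (condexpP FS FM (stopped_payoff_integrable t_range st))
    (optional_stopping F_filtration s_dates t_range st Ml_mart))
    (is_condexp_id (Ml_int _ t_range) (Ml_adapted _ t_range)).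
  have le_bound : {ae Pr, forall w,
      stopped P tau w - stopped Ml tau w + Ml t w <= bound logmax w}.
    apply: filterS (stopped_payoff_le st) => w /le_trans; apply.
    by rewrite /bound -/n le_eqVlt; apply/orP; left; apply/eqP; ring.
  by apply: filterS (is_condexp_le FS FM E boundE le_bound) => w; rewrite subrK.
apply: filterS => w; rewrite /bound -/n -lerBlDl => /le_trans; apply.
by rewrite le_eqVlt; apply/orP; left; apply/eqP; rewrite /C0; ring.
Qed.

Lemma regularised_value_le : {ae Pr, forall w, Vl t w <= V t w}.
Proof.
have [[Vl_adapted _] _ _ _] := Vl_value.
have iVl := regularised_value_integrable F_filtration Vl_value t_range.
apply: (compensated_le_value (K := K) t_range _ _ (Vl_adapted _ t_range) iVl) => //.
  by move=> i j; rewrite -(date_le s_dates) => /le_trans; apply.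
by apply: filterS C_eq => w [_ ->].
Qed.
End Estimate.
End Main.

Theorem theorem3p1 (R : realType) (d : measure_display)
    (Omega : measurableType d) (Pr : probability Omega R)
    (F : R -> set (set Omega)) (T : R) (N : nat) (s : 'I_N.+1 -> R)
    (P V Vl Ml : R -> Omega -> R) (lambda t : R)
    (F_filtration : filtration F)
    (F_usual : usual_conditions Pr F)
    (T_gt0 : 0 < T)
    (s_dates : exercise_dates T s)
    (P_adapted : adapted T F P)
    (P_ge0 : forall u w, 0 <= u <= T -> 0 <= P u w)
    (P_integrable : forall u, (range s `|` [set T]) u -> ('E_Pr[P u] < +oo)%E)
    (V_value : value_process Pr T F (range s) P V)
    (lambda_gt0 : 0 < lambda) (lambda_lt1 : lambda < 1)
    (Vl_value : regularised_value Pr T F s P lambda Vl Ml)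
    (t_range : 0 <= t <= T) :
  {ae Pr, forall w,
    0 <= V t w - Vl t w <=
      (remaining_dates s t)%:R
      * (1 - ln (1 - expR (-1))
         + condexp Pr (F t) (fun w' => ln (Num.max (running_max T s V t w') 1)) w)
      * (lambda - lambda * ln lambda)}.
Proof.
have [C [C_meas C_int C_eq]] := continuation_value_exists F_filtration F_usual
  s_dates Vl_value.
apply: filterS2
  (regularised_value_le F_filtration s_dates P_adapted P_ge0 P_integrable
    V_value lambda_gt0 Vl_value C_meas C_eq t_range)
  (value_gap_le F_filtration s_dates P_adapted P_ge0 P_integrable
    V_value lambda_gt0 lambda_lt1 Vl_value C_meas C_int C_eq t_range).
by move=> w VlV gap; rewrite subr_ge0 VlV.
Qed.
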